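(* (a) The Coxeter polynomial and the refined Coxeter polynomials of an ordinal sum of finite posets do not depend on the order of the summands: for any finite posets $X_1,\dots,X_n$ and any permutation $\pi$ of $\{1,\dots,n\}$, the posets $X_1\oplus\cdots\oplus X_n$ and $X_{\pi(1)}\oplus\cdots\oplus X_{\pi(n)}$ have the same $\phi$, the same $\phi^0$ and the same $\phi^1$. (b) Let $X_1,\dots,X_n$ and $Y_1,\dots,Y_n$ be finite posets, and denote their ordinal sums by $X=X_1\oplus\cdots\oplus X_n$ and $Y=Y_1\oplus\cdots\oplus Y_n$. If $\phi_{X_i}=\phi_{Y_i}$ and $\phi_{\widehat{X_i}}=\phi_{\widehat{Y_i}}$ for all $1\le i\le n$, then $\phi_X=\phi_Y$ and $\phi_{\widehat{X}}=\phi_{\widehat{Y}}$.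
   Context: For a finite poset $S$, let $C_S$ be the $S\times S$ matrix with $(C_S)_{st}=1$ if $t\le s$ and $0$ otherwise (the Cartan matrix of the incidence algebra $KS$ over any field $K$). The Coxeter polynomial of $S$ is $\phi_S(x)=\det(xC_S+C_S^T)$, with $\phi_\varnothing=1$. The poset $\widehat{S}=S\cup\{\widehat{1}\}$ is obtained from $S$ by adjoining a new element $\widehat 1$ with $s<\widehat{1}$ for all $s\in S$. Refined Coxeter polynomials $\phi^0_S,\phi^1_S\in\mathbb{Z}[x]$: if $S=\varnothing$, $\phi^0_S=0$ and $\phi^1_S=1$. If $S\neq\varnothing$, choose $s\in S$, put $S'=S\setminus\{s\}$, and let $A$ be the matrix obtained from $xC_S+C_S^T$ by subtracting the $s$-th row from all other rows and then subtracting the $s$-th column from all other columns; then \[ \phi^0_S(x)=\sum_{\sigma\in\Sigma_{S'}}\mathrm{sgn}(\sigma)\prod_{i\in S'}A_{i\sigma(i)},\qquad \phi^1_S(x)=\sum_{\sigma\in\Sigma_S,\ \sigma(s)\ne s}\mathrm{sgn}(\sigma)\prod_{i\in S}A_{i\sigma(i)}, \] where $\Sigma_{S'},\Sigma_S$ are the permutation groups of $S'$ and $S$; these do not depend on the choice of $s$. The ordinal sum $X_1\oplus\cdots\oplus X_n$ of posets $(X_i,\le_i)$ is the disjoint union of the $X_i$ with $x\le y$ (for $x\in X_i$, $y\in X_j$) if and only if $i<j$, or $i=j$ and $x\le_i y$. *)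

(* Defs.v *)
From HB Require Import structures.
From mathcomp Require Import all_boot all_order all_fingroup all_algebra.

Set Implicit Arguments.
Unset Strict Implicit.
Unset Printing Implicit Defensive.

Import Order.Theory GRing.Theory.
Local Open Scope ring_scope.

(* S with a greatest element None adjoined. *)
Definition hat (S : Type) : Type := option S.

Section HatOrder.
Context {d : Order.disp_t} {S : finPOrderType d}.

HB.instance Definition _ := Finite.on (hat S).

Definition hat_le (x y : hat S) : bool :=
  match x, y with
  | _, None => true
  | None, Some _ => false
  | Some s, Some t => (s <= t)%O
  end.

Fact hat_le_refl : reflexive hat_le.
Proof. by case=> //= s; exact: lexx. Qed.

Fact hat_le_anti : antisymmetric hat_le.
Proof. by case=> [s|] [t|] //= /le_anti ->. Qed.

Fact hat_le_trans : transitive hat_le.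
Proof. by case=> [s|] [t|] [u|] //=; exact: le_trans. Qed.

HB.instance Definition _ := Order.Le_isPOrder.Build d (hat S)
  hat_le_refl hat_le_anti hat_le_trans.

End HatOrder.

Section Coxeter.
Context {d : Order.disp_t}.
Implicit Type S : finPOrderType d.

Definition cartan S (s t : S) : int := (t <= s)%O%:R.

(* The entries of x C_S + C_S^T, indexed by S itself. *)
Definition coxeter_entry S (s t : S) : {poly int} :=
  'X * (cartan s t)%:P + (cartan t s)%:P.

(* \det needs ordinal indices; any enumeration of S gives the same value,
   since it permutes rows and columns simultaneously. *)
Definition coxeter_poly S : {poly int} :=
  \det (\matrix_(i < #|S|, j < #|S|)
          coxeter_entry (enum_val i) (enum_val j)).

Definition sub_row S (s : S) (M : S -> S -> {poly int}) (i j : S) :=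
  if i == s then M i j else M i j - M s j.

Definition sub_col S (s : S) (M : S -> S -> {poly int}) (i j : S) :=
  if j == s then M i j else M i j - M i s.

Definition reduced_entry S (s : S) : S -> S -> {poly int} :=
  sub_col s (sub_row s (@coxeter_entry S)).

Definition refined0_at S (s : S) : {poly int} :=
  \sum_(sigma : {perm {x : S | x != s}})
    (-1) ^+ sigma * \prod_i reduced_entry s (val i) (val (sigma i)).

Definition refined1_at S (s : S) : {poly int} :=
  \sum_(sigma : {perm S} | sigma s != s)
    (-1) ^+ sigma * \prod_i reduced_entry s i (sigma i).

(* refined0_at and refined1_at do not depend on s, so the element picked
   is immaterial. *)
Definition refined0 S : {poly int} :=
  if [pick s : S] is Some s then refined0_at s else 0.

Definition refined1 S : {poly int} :=
  if [pick s : S] is Some s then refined1_at s else 1.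

End Coxeter.

(* {i : 'I_n & X i} carries the library's lexicographic order: first by index,
   then inside the fibre X i. *)
Definition ordinal_sum {d : Order.disp_t} {n : nat}
    (X : 'I_n -> finPOrderType d) : finPOrderType d :=
  {i : 'I_n & X i}.

(* Main.v *)
Require Import Defs.
From mathcomp Require Import all_boot all_order all_fingroup all_algebra.
From mathcomp Require Import ring.

Set Implicit Arguments.
Unset Strict Implicit.
Unset Printing Implicit Defensive.

Import Order.Theory GRing.Theory.
Local Open Scope ring_scope.

(** Write M_S = x C_S + C_S^T, and J for a matrix all of whose entries are 1.
   In an ordinal sum the entries of M linking different summands are all x
   (below the diagonal blocks) or all 1 (above them).  So M - J is block lower
   triangular and M - xJ is block upper triangular, with diagonal blocks
   M_{X_i} - J and M_{X_i} - xJ: the two polynomials det(M_S - J) and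
   det(M_S - xJ) are multiplicative for the ordinal sum
   ([shifted_det1_ordinal_sum], [shifted_detX_ordinal_sum]).

   These two polynomials carry the same information as the Coxeter polynomials.
   The row and column subtractions that define the refined polynomials turn J
   into the matrix unit at (s, s), hence det(M_S - cJ) = phi - c phi^0 for every
   c ([shifted_detE]).  Taking c = 1 and c = x gives a linear system of
   determinant 1 - x in phi and phi^0, and Z[x] is a domain, so the two shifted
   determinants determine phi and phi^0.  They determine phi^1 as well, since
   phi = (x + 1) phi^0 + phi^1 ([refined1E]).  Part (a) follows because a product
   in Z[x] does not depend on the order of its factors.

   Adjoining a greatest element multiplies det(M - J) by x and leaves
   det(M - xJ) unchanged.  Therefore the two shifted determinants also determine
   the Coxeter polynomial of the hat, and conversely
   x det(M_S - J) = phi_hat - phi recovers them from phi and phi_hat.  Part (b)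
   follows by passing from the pairs (phi, phi_hat) of the summands to shifted
   determinants, multiplying, and passing back. *)

(** * Permutations carried along a bijection *)

Section TransportedPermutation.
Variables (T1 T2 : finType) (f : T1 -> T2) (g : T2 -> T1).
Hypotheses (fK : cancel f g) (gK : cancel g f).

Fact perm_transport_inj (s : {perm T1}) : injective (fun y => f (s (g y))).
Proof. by move=> y z /(can_inj fK)/perm_inj/(can_inj gK). Qed.

Definition perm_transport (s : {perm T1}) : {perm T2} :=
  perm (perm_transport_inj (s := s)).

Lemma perm_transportE s x : perm_transport s (f x) = f (s x).
Proof. by rewrite permE fK. Qed.

(** Transport sends the transposition of x and y to that of f x and f y, so it
   keeps the length of a factorization into transpositions. *)
Lemma odd_perm_transport s : perm_transport s = s :> bool.
Proof.
have [ts -> dts] := prod_tpermP s.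
elim: ts dts => [_|[x y] ts IH /andP[/= dxy /IH {}IH]].
  rewrite !big_nil (_ : perm_transport 1 = 1%g) ?odd_perm1 //.
  by apply/permP=> y; rewrite -[y]gK perm_transportE !perm1.
rewrite !big_cons /= odd_mul_tperm -IH.
set t := (\prod_(_ <- _) _)%g.
have -> : perm_transport (tperm x y * t) = (tperm (f x) (f y) * perm_transport t)%g.
  apply/permP=> z; rewrite -[z]gK perm_transportE !permM -perm_transportE.
  by rewrite inj_tperm //; apply: can_inj fK.
by rewrite odd_mul_tperm (can_eq fK).
Qed.

End TransportedPermutation.

(** * Determinants indexed by an arbitrary finite type *)

Section FinDet.
Variable R : comNzRingType.
Implicit Types T A B : finType.

(** The Leibniz formula without an enumeration of T: the refined polynomials are
   sums over permutations of posets and of subtypes, and block decompositions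
   come from bijections of index types rather than from casts of dimensions. *)
Definition fin_det T (M : T -> T -> R) : R :=
  \sum_(s : {perm T}) (-1) ^+ s * \prod_i M i (s i).

Lemma eq_fin_det T (M N : T -> T -> R) :
  (forall i j, M i j = N i j) -> fin_det M = fin_det N.
Proof.
by move=> eqMN; apply: eq_bigr => s _; congr (_ * _); apply: eq_bigr.
Qed.

Lemma fin_det_bij A B (f : A -> B) (M : B -> B -> R) :
  bijective f -> fin_det (fun i j => M (f i) (f j)) = fin_det M.
Proof.
case=> g fK gK; rewrite /fin_det [RHS](reindex (perm_transport fK gK)) /=.
  apply: eq_bigr => s _; rewrite odd_perm_transport; congr (_ * _).
  rewrite [RHS](reindex f) /=; last by exists g => ? _.
  by apply: eq_bigr => i _; rewrite perm_transportE.
exists (perm_transport gK fK) => s _; apply/permP=> x.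
  by rewrite !permE /= !fK.
by rewrite !permE /= !gK.
Qed.

Lemma fin_det_ord n (M : 'I_n -> 'I_n -> R) :
  fin_det M = \det (\matrix_(i, j) M i j).
Proof. by apply: eq_bigr => s _; congr (_ * _); apply: eq_bigr => i _; rewrite mxE. Qed.

Lemma fin_det_enum T (M : T -> T -> R) :
  fin_det M = \det (\matrix_(i < #|T|, j < #|T|) M (enum_val i) (enum_val j)).
Proof. by rewrite -fin_det_ord fin_det_bij //; apply: enum_val_bij. Qed.

Lemma fin_det1 T : fin_det (fun i j : T => (j == i)%:R) = 1.
Proof.
rewrite fin_det_enum -[RHS](det1 R #|T|); congr (\det _).
by apply/matrixP => i j; rewrite !mxE (inj_eq enum_val_inj) eq_sym.
Qed.

Lemma fin_det_tr T (M : T -> T -> R) : fin_det (fun i j => M j i) = fin_det M.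
Proof.
by rewrite !fin_det_enum -[RHS]det_tr; congr (\det _); apply/matrixP => i j; rewrite !mxE.
Qed.

Lemma fin_detM T (M N : T -> T -> R) :
  fin_det (fun i j => \sum_k M i k * N k j) = fin_det M * fin_det N.
Proof.
rewrite !fin_det_enum -det_mulmx; congr (\det _).
apply/matrixP => i j; rewrite !mxE (reindex (fun k : 'I_#|T| => enum_val k)) /=.
  by apply: eq_bigr => k _; rewrite !mxE.
exact/onW_bij/enum_val_bij.
Qed.

Lemma fin_det_unit (M : unit -> unit -> R) : fin_det M = M tt tt.
Proof.
rewrite -(fin_det_bij (f := fun _ : 'I_1 => tt)) ?fin_det_ord ?det_mx11 ?mxE //.
by exists (fun=> ord0) => [i|[]] //; rewrite [i]ord1.
Qed.

Lemma fin_det_lower_sum A B (M : A + B -> A + B -> R) :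
  (forall a b, M (inl a) (inr b) = 0) ->
  fin_det M = fin_det (fun i j => M (inl i) (inl j))
              * fin_det (fun i j => M (inr i) (inr j)).
Proof.
move=> M0.
pose f (k : 'I_(#|A| + #|B|)) : A + B :=
  match split k with inl i => inl (enum_val i) | inr i => inr (enum_val i) end.
pose g (x : A + B) : 'I_(#|A| + #|B|) :=
  match x with inl a => lshift _ (enum_rank a) | inr b => rshift _ (enum_rank b) end.
have fL i : f (lshift _ i) = inl (enum_val i) by rewrite /f (unsplitK (inl i)).
have fR i : f (rshift _ i) = inr (enum_val i) by rewrite /f (unsplitK (inr i)).
have bij_f : bijective f.
  exists g => [k|[a|b]] /=; last by rewrite fR enum_rankK.
    by case: (split_ordP k) => i ->; rewrite ?fL ?fR /= enum_valK.
  by rewrite fL enum_rankK.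
rewrite -(fin_det_bij _ bij_f) fin_det_ord !fin_det_enum.
set Mf := (X in \det X = _).
rewrite -[Mf]submxK (_ : ursubmx Mf = 0); last first.
  by apply/matrixP => i j; rewrite !mxE fL fR.
rewrite det_lblock; congr (_ * _); congr determinant.
  by apply/matrixP => i j; rewrite !mxE !fL.
by apply/matrixP => i j; rewrite !mxE !fR.
Qed.

Lemma fin_det_lower_option A (M : option A -> option A -> R) :
  (forall a, M (Some a) None = 0) ->
  fin_det M = fin_det (fun i j => M (Some i) (Some j)) * M None None.
Proof.
move=> M0; pose f (x : A + unit) := if x is inl a then Some a else None.
have bij_f : bijective f.
  by exists (fun x => if x is Some a then inl a else inr tt) => [[a|[]]|[a|]].
by rewrite -(fin_det_bij _ bij_f) fin_det_lower_sum ?fin_det_unit // => a []; apply: M0.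
Qed.

Definition sigma_split n (T : 'I_n.+1 -> finType)
    (x : T ord0 + {i : 'I_n & T (lift ord0 i)}) : {i : 'I_n.+1 & T i} :=
  match x with
  | inl a => Tagged T a
  | inr u => Tagged T (tagged u)
  end.

Lemma sigma_split_bij n (T : 'I_n.+1 -> finType) : bijective (@sigma_split n T).
Proof.
apply: inj_card_bij; last first.
  rewrite card_sum !card_tagged enum_ordSl /= -map_comp leqnn //.
move=> [a|[i a]] [b|[j b]] //=.
- by move/eqP; rewrite eq_Tagged => /eqP /= ->.
- move=> e.
  have ij : lift ord0 i = lift ord0 j := congr1 tag e.
  have {}ij := lift_inj ij; case: _ / ij b e => b.
  by move/eqP; rewrite eq_Tagged => /eqP /= ->.
Qed.

(** Induction on n: splitting off the fibre over the first index leaves a 2 x 2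
   block lower triangular matrix. *)
Lemma fin_det_lower_sigma n (T : 'I_n -> finType)
    (M : {i : 'I_n & T i} -> {i : 'I_n & T i} -> R) :
  (forall u v : {i : 'I_n & T i}, (tag u < tag v)%N -> M u v = 0) ->
  fin_det M = \prod_i fin_det (fun x y => M (Tagged T (i := i) x) (Tagged T y)).
Proof.
elim: n T M => [|n IH] T M M0.
  rewrite big_ord0 -(fin_det1 {i : 'I_0 & T i}).
  by apply: eq_fin_det => - [[]].
rewrite -(fin_det_bij _ (sigma_split_bij T)) fin_det_lower_sum; last first.
  by move=> a u; apply: M0.
rewrite big_ord_recl; congr (_ * _).
by rewrite (IH (fun i => T (lift ord0 i))) // => u v uv; apply: M0.
Qed.

(** Replacing row s by the unit vector e_s encodes the minor at (s, s) as a
   determinant over the same index type. *)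
Definition unit_row T (s : T) (M : T -> T -> R) (i j : T) : R :=
  if i == s then (j == s)%:R else M i j.

Lemma fin_det_unit_row T (s : T) (M : T -> T -> R) :
  fin_det (unit_row s M) =
  fin_det (fun i j : {x : T | x != s} => M (val i) (val j)).
Proof.
pose f (x : unit + {x : T | x != s}) := if x is inr y then val y else s.
have bij_f : bijective f.
  exists (fun x => if insub x is Some y then inr y else inl tt).
    by case=> [[]|y] /=; rewrite ?valK // insubF // eqxx.
  by move=> x; case: insubP => [y _ //|]; rewrite negbK => /eqP.
rewrite -(fin_det_bij _ bij_f) fin_det_lower_sum /= => [|[] [x xs]]; last first.
  by rewrite /unit_row eqxx (negPf xs).
rewrite fin_det_unit /unit_row !eqxx mul1r; apply: eq_fin_det => i j.
by rewrite (negPf (valP i)).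
Qed.

Lemma prod_unit_row T (s : T) (M : T -> T -> R) (p : {perm T}) :
  \prod_i unit_row s M i (p i) = (p s == s)%:R * \prod_(i | i != s) M i (p i).
Proof.
rewrite (bigD1 s) //= {1}/unit_row eqxx; congr (_ * _).
by apply: eq_bigr => i is_; rewrite /unit_row (negPf is_).
Qed.

(** The permutations fixing s contribute the entry at (s, s) times its minor;
   the others give a sum of the shape of phi^1. *)
Lemma fin_det_split_fixed T (s : T) (M : T -> T -> R) :
  fin_det M = M s s * fin_det (unit_row s M)
    + \sum_(p : {perm T} | p s != s) (-1) ^+ p * \prod_i M i (p i).
Proof.
rewrite {1}/fin_det (bigID (fun p : {perm T} => p s == s)) /=; congr (_ + _).
rewrite /fin_det big_distrr big_mkcond /=; apply: eq_bigr => p _.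
rewrite prod_unit_row; case: eqP => [ps|_]; last by rewrite mul0r !mulr0.
by rewrite (bigD1 s) //= ps mul1r mulrCA.
Qed.

(** Linearity in row s, for a change of the single entry at (s, s). *)
Lemma fin_det_add_corner T (s : T) (c : R) (M : T -> T -> R) :
  fin_det (fun i j => M i j + c * ((i == s) && (j == s))%:R)
  = fin_det M + c * fin_det (unit_row s M).
Proof.
rewrite /fin_det big_distrr -big_split /=; apply: eq_bigr => p _.
rewrite prod_unit_row (bigD1 s) //= [in RHS](bigD1 s) //= eqxx /=.
have -> : \prod_(i | i != s) (M i (p i) + c * ((i == s) && (p i == s))%:R)
          = \prod_(i | i != s) M i (p i).
  by apply: eq_bigr => i /negPf->; rewrite mulr0 addr0.
by rewrite mulrDl mulrDr -(mulrA c) (mulrCA _ c).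
Qed.

End FinDet.

(** * The reduction of the refined Coxeter polynomials *)

Section Reduction.
Context {d : Order.disp_t} (S : finPOrderType d) (s : S).
Implicit Type M : S -> S -> {poly int}.

(** Subtracting row s from the other rows is left multiplication by a matrix E
   with row s equal to e_s and with identity minor at (s, s); so det E = 1. *)
Lemma fin_det_sub_row M : fin_det (sub_row s M) = fin_det M.
Proof.
pose E (i k : S) : {poly int} := (k == i)%:R - (if i == s then 0 else (k == s)%:R).
have detE : fin_det E = 1.
  rewrite -(fin_det1 _ {x | x != s}).
  transitivity (fin_det (unit_row s E)).
    apply: eq_fin_det => i j; rewrite /unit_row /E.
    by have [->|//] := eqVneq i s; rewrite subr0.
  rewrite fin_det_unit_row; apply: eq_fin_det => i j.
  by rewrite /E (negPf (valP i)) (negPf (valP j)) subr0.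
rewrite -[RHS]mul1r -detE -fin_detM; apply: eq_fin_det => i j.
have delta a : \sum_k (k == a)%:R * M k j = M a j.
  by rewrite (bigD1 a) //= eqxx mul1r big1 ?addr0 // => k /negPf->; rewrite mul0r.
rewrite /sub_row /E; case: ifP => _.
  by under eq_bigr do rewrite subr0; rewrite delta.
by under eq_bigr do rewrite mulrBl; rewrite big_split /= sumrN !delta.
Qed.

Lemma fin_det_sub_col M : fin_det (sub_col s M) = fin_det M.
Proof. by rewrite -fin_det_tr [LHS]fin_det_sub_row fin_det_tr. Qed.

End Reduction.

(** * Coxeter polynomials and shifted determinants *)

Section ShiftedDeterminant.
Context {d : Order.disp_t}.
Implicit Type S : finPOrderType d.

Definition shifted_det S (c : {poly int}) : {poly int} :=
  fin_det (fun s t : S => coxeter_entry s t - c).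

Lemma coxeter_polyE S : coxeter_poly S = fin_det (@coxeter_entry d S).
Proof. by rewrite fin_det_enum. Qed.

Lemma refined0_atE S (s : S) :
  refined0_at s = fin_det (unit_row s (reduced_entry s)).
Proof. by rewrite fin_det_unit_row. Qed.

(** The reduction at s sends the all-ones matrix to the matrix unit at (s, s), so
   the shift by c only changes the corner entry, whose minor is phi^0. *)
Lemma shifted_detE S c : shifted_det S c = coxeter_poly S - c * refined0 S.
Proof.
rewrite coxeter_polyE /shifted_det /refined0; case: pickP => [s _|S0]; last first.
  by rewrite mulr0 subr0; apply: eq_fin_det => s; have := S0 s.
rewrite -(fin_det_sub_row s) -(fin_det_sub_col s) refined0_atE.
rewrite -[in RHS](fin_det_sub_row s) -[in RHS](fin_det_sub_col s) -mulNr.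
rewrite -fin_det_add_corner; apply: eq_fin_det => i j.
rewrite /sub_col /sub_row.
by case: (i == s); case: (j == s) => /=; ring.
Qed.

(** The reduced matrix has the entry x + 1 at (s, s), the diagonal entry of
   x C_S + C_S^T. *)
Lemma refined1E S : refined1 S = coxeter_poly S - ('X + 1) * refined0 S.
Proof.
rewrite coxeter_polyE /refined1 /refined0; case: pickP => [s _|S0]; last first.
  rewrite mulr0 subr0 -(fin_det1 _ S).
  by apply: eq_fin_det => s; have := S0 s.
rewrite -(fin_det_sub_row s) -(fin_det_sub_col s) refined0_atE.
rewrite (fin_det_split_fixed s) -/(reduced_entry s) -/(refined1_at s).
have -> : reduced_entry s s s = 'X + 1.
  by rewrite /reduced_entry /sub_col /sub_row !eqxx /coxeter_entry /cartan lexx mulr1.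
by rewrite addrC addKr.
Qed.

Lemma subX1_neq0 : 'X - 1 != 0 :> {poly int}.
Proof. by rewrite -[1]polyC1 polyXsubC_eq0. Qed.

(** Together with [refined0_shifted], Cramer's rule for the system
   f = phi - phi^0, g = phi - x phi^0. *)
Lemma coxeter_poly_shifted S :
  ('X - 1) * coxeter_poly S = 'X * shifted_det S 1 - shifted_det S 'X.
Proof. by rewrite !shifted_detE; ring. Qed.

Lemma refined0_shifted S :
  ('X - 1) * refined0 S = shifted_det S 1 - shifted_det S 'X.
Proof. by rewrite !shifted_detE; ring. Qed.

(** The column of the greatest element is 1 outside the diagonal and x + 1 on it;
   the shift by 1 clears it and leaves the diagonal entry x. *)
Lemma shifted_det_hat1 S : shifted_det (hat S) 1 = 'X * shifted_det S 1.
Proof.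
rewrite /shifted_det fin_det_lower_option /= => [|a].
  by rewrite {2}/coxeter_entry /cartan lexx mulr1 addrK mulrC.
by rewrite /coxeter_entry /cartan /= polyC0 mulr0 add0r subrr.
Qed.

(** The row of the greatest element is x outside the diagonal and x + 1 on it;
   the shift by x clears it and leaves the diagonal entry 1. *)
Lemma shifted_det_hatX S : shifted_det (hat S) 'X = shifted_det S 'X.
Proof.
rewrite /shifted_det -fin_det_tr fin_det_lower_option /= => [|a].
  rewrite {2}/coxeter_entry /cartan lexx mulr1 addrC addKr mulr1.
  by rewrite -[RHS]fin_det_tr.
by rewrite /coxeter_entry /cartan /= polyC0 mulr1 addr0 subrr.
Qed.

(** With f = det(M_S - J) and g = det(M_S - xJ) one has (x - 1) phi = x f - g and
   (x - 1) phi_hat = x (x f) - g; subtracting eliminates g. *)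
Lemma shifted_det1_hat S :
  'X * shifted_det S 1 = coxeter_poly (hat S) - coxeter_poly S.
Proof.
apply: (mulfI subX1_neq0); rewrite mulrBr !coxeter_poly_shifted.
by rewrite shifted_det_hat1 shifted_det_hatX; ring.
Qed.

(** * Multiplicativity over ordinal sums *)

Section OrdinalSum.
Variables (n : nat) (X : 'I_n -> finPOrderType d).

Lemma coxeter_entry_same (i : 'I_n) (x y : X i) :
  coxeter_entry (Tagged X x : ordinal_sum X) (Tagged X y) = coxeter_entry x y.
Proof.
by rewrite /coxeter_entry /cartan !Order.SigmaOrder.leEsig /= !lexx !tagged_asE.
Qed.

Lemma coxeter_entry_lt (u v : ordinal_sum X) :
  (tag u < tag v)%N -> coxeter_entry u v = 1.
Proof.
move=> uv; rewrite /coxeter_entry /cartan !Order.SigmaOrder.leEsig /=.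
by rewrite !leEord leqNgt uv (ltnW uv) /= polyC0 mulr0 add0r.
Qed.

Lemma coxeter_entry_gt (u v : ordinal_sum X) :
  (tag v < tag u)%N -> coxeter_entry u v = 'X.
Proof.
move=> vu; rewrite /coxeter_entry /cartan !Order.SigmaOrder.leEsig /=.
by rewrite !leEord [(tag u <= _)%N]leqNgt vu (ltnW vu) /= polyC0 mulr1 addr0.
Qed.

(** The entries above the diagonal blocks are 1, so the shift by 1 makes the
   matrix block lower triangular. *)
Lemma shifted_det1_ordinal_sum :
  shifted_det (ordinal_sum X) 1 = \prod_i shifted_det (X i) 1.
Proof.
rewrite /shifted_det fin_det_lower_sigma => [|u v uv]; last first.
  by rewrite coxeter_entry_lt ?subrr.
apply: eq_bigr => i _; apply: eq_fin_det => x y.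
by rewrite coxeter_entry_same.
Qed.

(** The entries below the diagonal blocks are x, so the shift by x makes the
   transpose block lower triangular. *)
Lemma shifted_detX_ordinal_sum :
  shifted_det (ordinal_sum X) 'X = \prod_i shifted_det (X i) 'X.
Proof.
rewrite /shifted_det -fin_det_tr fin_det_lower_sigma => [|u v uv]; last first.
  by rewrite coxeter_entry_gt ?subrr.
apply: eq_bigr => i _; rewrite -[RHS]fin_det_tr; apply: eq_fin_det => x y.
by rewrite coxeter_entry_same.
Qed.

End OrdinalSum.
End ShiftedDeterminant.

(** * Equivalence of the two pairs of invariants *)

Lemma coxeter_polys_of_shifted d (S T : finPOrderType d) :
  shifted_det S 1 = shifted_det T 1 -> shifted_det S 'X = shifted_det T 'X ->
  [/\ coxeter_poly S = coxeter_poly T, refined0 S = refined0 T,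
      refined1 S = refined1 T & coxeter_poly (hat S) = coxeter_poly (hat T)].
Proof.
move=> eq1 eqX.
have eq_phi : coxeter_poly S = coxeter_poly T.
  by apply: (mulfI subX1_neq0); rewrite !coxeter_poly_shifted eq1 eqX.
have eq_phi0 : refined0 S = refined0 T.
  by apply: (mulfI subX1_neq0); rewrite !refined0_shifted eq1 eqX.
split=> //; first by rewrite !refined1E eq_phi eq_phi0.
apply: (mulfI subX1_neq0); rewrite !coxeter_poly_shifted.
by rewrite !shifted_det_hat1 !shifted_det_hatX eq1 eqX.
Qed.

Lemma shifted_of_coxeter_polys d (S T : finPOrderType d) :
  coxeter_poly S = coxeter_poly T ->
  coxeter_poly (hat S) = coxeter_poly (hat T) ->
  shifted_det S 1 = shifted_det T 1 /\ shifted_det S 'X = shifted_det T 'X.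
Proof.
move=> eq_phi eq_hat.
have eq1 : shifted_det S 1 = shifted_det T 1.
  by apply: (mulfI (negbT (polyX_eq0 _))); rewrite !shifted_det1_hat eq_phi eq_hat.
split=> //; have := coxeter_poly_shifted S.
by rewrite eq_phi coxeter_poly_shifted eq1 => /addrI/oppr_inj.
Qed.

Theorem corollary4p3 :
  (forall (d : Order.disp_t) (n : nat) (X : 'I_n -> finPOrderType d)
      (pi : 'S_n),
    [/\ coxeter_poly (ordinal_sum (fun i : 'I_n => X (pi i)))
          = coxeter_poly (ordinal_sum X),
        refined0 (ordinal_sum (fun i : 'I_n => X (pi i)))
          = refined0 (ordinal_sum X)
      & refined1 (ordinal_sum (fun i : 'I_n => X (pi i)))
          = refined1 (ordinal_sum X)])
  /\
  (forall (d : Order.disp_t) (n : nat) (X Y : 'I_n -> finPOrderType d),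
    (forall i : 'I_n, coxeter_poly (X i) = coxeter_poly (Y i)) ->
    (forall i : 'I_n, coxeter_poly (hat (X i)) = coxeter_poly (hat (Y i))) ->
    coxeter_poly (ordinal_sum X) = coxeter_poly (ordinal_sum Y) /\
    coxeter_poly (hat (ordinal_sum X)) = coxeter_poly (hat (ordinal_sum Y))).
Proof.
split=> [d n X pi|d n X Y eq_phi eq_hat].
  have [] // := @coxeter_polys_of_shifted d
    (ordinal_sum (fun i => X (pi i))) (ordinal_sum X).
    rewrite !shifted_det1_ordinal_sum.
    by rewrite [RHS](reindex_inj (@perm_inj _ pi)).
  rewrite !shifted_detX_ordinal_sum.
  by rewrite [RHS](reindex_inj (@perm_inj _ pi)).
have eqXY i := shifted_of_coxeter_polys (eq_phi i) (eq_hat i).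
have [] // := @coxeter_polys_of_shifted d (ordinal_sum X) (ordinal_sum Y).
  by rewrite !shifted_det1_ordinal_sum; apply: eq_bigr => i _; case: (eqXY i).
by rewrite !shifted_detX_ordinal_sum; apply: eq_bigr => i _; case: (eqXY i).
Qed.
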